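(* Assume $\Phi$ is 1-strongly convex with respect to a norm $\|\cdot\|_\omega$, i.e. $D_\Phi(x,y)\ge\frac12\|x-y\|_\omega^2$, and that $\nabla^2\Phi$ is $L$-Lipschitz, i.e. $$\|\nabla^2\Phi(x)-\nabla^2\Phi(y)\|_2\le L\|x-y\|_2 .$$ Let $\{u^k\}$ be generated from $u^0=u_0$ by the variable metric iteration $$u^{k+1}=u^k-\eta\,\nabla^2\Phi(u^k)^{-1}\big(\nabla f(u^k)+A^\top c(u^k)\big),\qquad k\ge 0,$$ with stepsize $\eta>0$, where $c(u^k)\in\mathbb R^m$ is the vector such that $Au^{k+1}=b$. Then for every integer $K\ge1$, $$f\left(\frac1K\sum_{k=0}^{K-1}u^k\right)-f(u^* )\le\frac{1}{\eta K}D_\Phi(u^*,u_0)+\frac1K\sum_{k=0}^{K-1}\frac{\eta}{2}\|\nabla f(u^k)+A^\top c(u^k)\|_{\omega,*}^2+\frac{L\eta}{2}\,\frac1K\sum_{k=0}^{K-1}\Big[\|\nabla^2\Phi(u^k)^{-1}(\nabla f(u^k)+A^\top c(u^k))\|_2^2\,\|u^*-u^{k+1}\|_2\Big],$$ where $\|\cdot\|_{\omega,*}$ is the dual norm of $\|\cdot\|_\omega$.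
   Context: Setting: $\Omega\subset\mathbb R^n$ is convex, $f:\Omega\to\mathbb R$ is a convex differentiable function, $A\in\mathbb R^{m\times n}$, $b\in\mathbb R^m$ ($m\ge 0$; $m=0$ means no constraint). The problem $\min_{u\in\Omega:\,Au=b} f(u)$ is assumed to have a unique solution $u^*$. $\Phi:\Omega\to\mathbb R$ is twice differentiable, with Bregman divergence $D_\Phi(x,y)=\Phi(x)-\Phi(y)-\nabla\Phi(y)^\top(x-y)$. $\|\cdot\|_2$ is the Euclidean norm of vectors and the induced operator norm of matrices. The iterates lie in $\Omega$ and the initial point satisfies $Au_0=b$. *)

(* Defs.v *)
From HB Require Import structures.
From mathcomp Require Import all_boot all_order all_algebra.
From mathcomp Require Import all_classical all_reals all_analysis.

Set Implicit Arguments.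
Unset Strict Implicit.
Unset Printing Implicit Defensive.

Import Order.TTheory GRing.Theory Num.Theory.
Import numFieldNormedType.Exports.

Local Open Scope classical_set_scope.
Local Open Scope ring_scope.

(** ** Norms on R^n

    The norm that the library puts on matrices is the sup norm, hence the
    Euclidean and operator norms below. *)

Definition dot (R : realType) (n : nat) (x y : 'cV[R]_n) : R :=
  (x^T *m y) ord0 ord0.

Definition norm2 (R : realType) (n : nat) (x : 'cV[R]_n) : R :=
  Num.sqrt (dot x x).

Definition opnorm2 (R : realType) (m n : nat) (M : 'M[R]_(m, n)) : R :=
  sup [set norm2 (M *m x) | x in [set x : 'cV[R]_n | norm2 x <= 1]].

Record is_norm (R : realType) (n : nat) (N : 'cV[R]_n -> R) : Prop := IsNorm {
  is_norm_triangle : forall x y, N (x + y) <= N x + N y ;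
  is_norm_scale : forall (a : R) x, N (a *: x) = `|a| * N x ;
  is_norm_eq0 : forall x, N x = 0 -> x = 0
}.

Definition dual_norm (R : realType) (n : nat) (N : 'cV[R]_n -> R)
    (y : 'cV[R]_n) : R :=
  sup [set dot y x | x in [set x : 'cV[R]_n | N x <= 1]].

(** ** Differentiability on a subset of R^n

    Functions on [Omega] are represented by total functions, only the values on
    [Omega] being relevant: the remainder is o(y - x) as y tends to x inside
    [Omega].  At interior points this is Fréchet differentiability, and the
    derivative is unique as soon as [Omega] is convex with nonempty interior.
    The little-o uses the sup norm of ['cV[R]_n], which is equivalent to
    [norm2]. *)

Definition has_diff_within (R : realType) (n : nat) (W : normedModType R)
    (Omega : set 'cV[R]_n) (F : 'cV[R]_n -> W) (x : 'cV[R]_n)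
    (dF : 'cV[R]_n -> W) : Prop :=
  forall y, F y = F x + dF (y - x) +o_(y \near within Omega (nbhs x)) (y - x).

Definition gradient_on (R : realType) (n : nat) (Omega : set 'cV[R]_n)
    (f : 'cV[R]_n -> R) (gradf : 'cV[R]_n -> 'cV[R]_n) : Prop :=
  forall x, Omega x -> has_diff_within Omega f x (dot (gradf x)).

(* [hess] is the derivative on [Omega] of the gradient field [grad]. *)
Definition hessian_on (R : realType) (n : nat) (Omega : set 'cV[R]_n)
    (grad : 'cV[R]_n -> 'cV[R]_n) (hess : 'cV[R]_n -> 'M[R]_n) : Prop :=
  forall x, Omega x -> has_diff_within Omega grad x (mulmx (hess x)).

Definition bregman (R : realType) (n : nat) (Phi : 'cV[R]_n -> R)
    (gradPhi : 'cV[R]_n -> 'cV[R]_n) (x y : 'cV[R]_n) : R :=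
  Phi x - Phi y - dot (gradPhi y) (x - y).

Definition unique_minimizer (R : realType) (n : nat) (S : set 'cV[R]_n)
    (f : 'cV[R]_n -> R) (x : 'cV[R]_n) : Prop :=
  [/\ S x, forall y, S y -> f x <= f y
    & forall y, S y -> (forall z, S z -> f y <= f z) -> y = x].

(* Main.v *)
Require Import Defs.
From HB Require Import structures.
From mathcomp Require Import all_boot all_order all_algebra.
From mathcomp Require Import all_classical all_reals all_analysis.
From mathcomp Require Import ring lra.

(** The iteration is a mirror-descent step in which the difference of the
    gradients of [Phi] is replaced by its linearisation at the current point.
    Write [g] for [gradf (u k) + A^T *m c (u k)] and [D] for the Bregman
    divergence of [Phi].

    Both [u k] and [ustar] solve [A v = b], so the multiplier term is orthogonal
    to [u k - ustar], and convexity of [f] gives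
    [f (u k) - f ustar <= dot g (u k - ustar)].  The step says that
    [eta *: g = hessPhi (u k) *m (u k - u k.+1)], which equals
    [gradPhi (u k) - gradPhi (u k.+1)] up to a Taylor remainder bounded by
    [L / 2 * norm2 (u k - u k.+1) ^+ 2], the Hessian being Lipschitz
    ([gradient_taylor_le]).  The pairing of that difference with
    [u k.+1 - ustar] is [D ustar (u k) - D ustar (u k.+1) - D (u k.+1) (u k)]
    by the three-point identity.  The pairing of [g] with [u k - u k.+1] is
    bounded through the dual norm and Young's inequality: this leaves the squared
    dual norm of the statement and half of [omega (u k - u k.+1) ^+ 2], which
    [D (u k.+1) (u k)] absorbs by strong convexity.  This is [variable_metric_step]; summing it over [k] telescopes,
    and [convex_function_mean_le] passes to the averaged iterate.

    Two points are not formal.  The inequalities for the dual and operator norms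
    hold because the suprema defining them are taken over bounded sets, which
    for the dual norm is the comparison of norms in finite dimension
    ([mx_norm_le_is_norm]).  And the Hessian must be invertible for the step
    equation to be usable: when [Omega] has interior points it is even coercive
    ([hessian_coercive]), also at the boundary points of [Omega]. *)

Set Implicit Arguments.
Unset Strict Implicit.
Unset Printing Implicit Defensive.

Import Order.TTheory GRing.Theory Num.Theory.
Import numFieldNormedType.Exports.

Local Open Scope classical_set_scope.
Local Open Scope ring_scope.

(** * Euclidean norm and operator norm *)

Lemma ler_mx_norm_entry (R : realType) m n (M : 'M[R]_(m, n)) i j :
  `|M i j| <= `|M|.
Proof.
rewrite [leRHS]/Num.Def.normr/= mx_normrE.
exact: (le_bigmax _ (fun ij : 'I_m * 'I_n => `|M ij.1 ij.2|) (i, j)).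
Qed.

Section Euclidean.
Variable R : realType.

Lemma dotE n (x y : 'cV[R]_n) : dot x y = \sum_i x i ord0 * y i ord0.
Proof. by rewrite /dot mxE; apply: eq_bigr => i _; rewrite mxE. Qed.

Lemma dotC n (x y : 'cV[R]_n) : dot x y = dot y x.
Proof. by rewrite !dotE; apply: eq_bigr => i _; rewrite mulrC. Qed.

Lemma dotDr n (x y z : 'cV[R]_n) : dot x (y + z) = dot x y + dot x z.
Proof. by rewrite /dot mulmxDr mxE. Qed.

Lemma dotZr n a (x y : 'cV[R]_n) : dot x (a *: y) = a * dot x y.
Proof. by rewrite /dot -scalemxAr mxE. Qed.

Lemma dot0r n (x : 'cV[R]_n) : dot x 0 = 0.
Proof. by rewrite -(scale0r 0) dotZr mul0r. Qed.

Lemma dotNr n (x y : 'cV[R]_n) : dot x (- y) = - dot x y.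
Proof. by rewrite -scaleN1r dotZr mulN1r. Qed.

Lemma dotBr n (x y z : 'cV[R]_n) : dot x (y - z) = dot x y - dot x z.
Proof. by rewrite dotDr dotNr. Qed.

Lemma dotDl n (x y z : 'cV[R]_n) : dot (x + y) z = dot x z + dot y z.
Proof. by rewrite dotC dotDr !(dotC z). Qed.

Lemma dotZl n a (x y : 'cV[R]_n) : dot (a *: x) y = a * dot x y.
Proof. by rewrite dotC dotZr dotC. Qed.

Lemma dotNl n (x y : 'cV[R]_n) : dot (- x) y = - dot x y.
Proof. by rewrite dotC dotNr dotC. Qed.

Lemma dotBl n (x y z : 'cV[R]_n) : dot (x - y) z = dot x z - dot y z.
Proof. by rewrite dotDl dotNl. Qed.

Lemma dot_sumr n (x : 'cV[R]_n) (I : Type) (s : seq I) (F : I -> 'cV[R]_n) :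
  dot x (\sum_(i <- s) F i) = \sum_(i <- s) dot x (F i).
Proof.
exact: (big_morph (dot x) (dotDr x) (dot0r x)).
Qed.

Lemma dot_trmxl m n (M : 'M[R]_(m, n)) c x : dot (M^T *m c) x = dot c (M *m x).
Proof. by rewrite /dot trmx_mul trmxK mulmxA. Qed.

Lemma dot_ge0 n (x : 'cV[R]_n) : 0 <= dot x x.
Proof. by rewrite dotE sumr_ge0// => i _; rewrite -expr2 sqr_ge0. Qed.

Lemma norm2_ge0 n (x : 'cV[R]_n) : 0 <= norm2 x.
Proof. exact: sqrtr_ge0. Qed.

Lemma sqr_norm2 n (x : 'cV[R]_n) : norm2 x ^+ 2 = dot x x.
Proof. by rewrite sqr_sqrtr// dot_ge0. Qed.

Lemma norm2Z n a (x : 'cV[R]_n) : norm2 (a *: x) = `|a| * norm2 x.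
Proof.
by rewrite /norm2 dotZl dotZr mulrA -expr2 sqrtrM ?sqr_ge0// sqrtr_sqr.
Qed.

Lemma norm20 n : norm2 (0 : 'cV[R]_n) = 0.
Proof. by rewrite /norm2 dot0r sqrtr0. Qed.

Lemma norm2N n (x : 'cV[R]_n) : norm2 (- x) = norm2 x.
Proof. by rewrite -scaleN1r norm2Z normrN1 mul1r. Qed.

Lemma norm2_eq0 n (x : 'cV[R]_n) : norm2 x = 0 -> x = 0.
Proof.
move=> x0; have /eqP := sqr_norm2 x; rewrite x0 expr0n/= eq_sym dotE.
rewrite psumr_eq0 => [/allP x_eq0|i _]; last by rewrite -expr2 sqr_ge0.
apply/matrixP => i j; rewrite (ord1 j) mxE.
by have := x_eq0 i (mem_index_enum i); rewrite -expr2 sqrf_eq0 => /eqP.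
Qed.

(** Expand the square of [|y| x - |x| y]. *)
Lemma cauchy_schwarz n (x y : 'cV[R]_n) : dot x y <= norm2 x * norm2 y.
Proof.
have [/eqP x0|x0] := eqVneq (norm2 x * norm2 y) 0.
  move: x0; rewrite mulf_eq0 => /orP[/eqP/norm2_eq0 ->|/eqP/norm2_eq0 ->].
    by rewrite dotC dot0r norm20 mul0r.
  by rewrite dot0r norm20 mulr0.
have p_gt0 : 0 < norm2 x * norm2 y.
  by rewrite lt_neqAle eq_sym x0 mulr_ge0// norm2_ge0.
have := dot_ge0 (norm2 y *: x - norm2 x *: y).
rewrite !(dotBl, dotBr, dotZl, dotZr) (dotC y x) -!sqr_norm2 => sq.
rewrite -(ler_pM2l p_gt0); nra.
Qed.

(** Hölder's inequality between the sup norm that topologises matrices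
    and its dual: it turns estimates on vector-valued remainders into scalar ones. *)
Lemma dot_le_mx_norm n (x y : 'cV[R]_n) :
  `|dot x y| <= (\sum_i `|x i ord0|) * `|y|.
Proof.
rewrite dotE mulr_suml; apply: le_trans (ler_norm_sum _ _ _) _.
apply: ler_sum => i _; rewrite normrM ler_wpM2l//.
exact: ler_mx_norm_entry.
Qed.

(** The Frobenius norm dominates the operator norm; all that matters is that the
    supremum defining [opnorm2] is over a bounded set. *)
Lemma norm2_mulmx_bound m n (M : 'M[R]_(m, n)) x :
  norm2 (M *m x) <=
    Num.sqrt (\sum_i norm2 (row i M)^T ^+ 2) * norm2 x.
Proof.
have sum_ge0 : 0 <= \sum_i norm2 (row i M)^T ^+ 2.
  by apply: sumr_ge0 => i _; exact: sqr_ge0.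
rewrite -[leRHS]ger0_norm ?mulr_ge0 ?sqrtr_ge0// -sqrtr_sqr.
rewrite exprMn sqr_sqrtr// /norm2 ler_wsqrtr// dotE sqr_sqrtr ?dot_ge0//.
rewrite mulr_suml; apply: ler_sum => i _.
have -> : (M *m x) i ord0 = dot (row i M)^T x.
  by rewrite dotE mxE; apply: eq_bigr => j _; rewrite !mxE.
rewrite -/(norm2 _) -sqr_norm2 -expr2 -exprMn -real_normK ?num_real//.
rewrite ler_sqr ?nnegrE ?mulr_ge0 ?norm2_ge0// ler_norml.
rewrite cauchy_schwarz andbT lerNl -dotNl.
by rewrite (le_trans (cauchy_schwarz _ _))// norm2N.
Qed.

Lemma le_opnorm2 m n (M : 'M[R]_(m, n)) x :
  norm2 (M *m x) <= opnorm2 M * norm2 x.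
Proof.
have [x0|x_neq0] := eqVneq (norm2 x) 0.
  by rewrite (norm2_eq0 x0) mulmx0 !norm20 mulr0.
have x_gt0 : 0 < norm2 x by rewrite lt_neqAle eq_sym x_neq0 norm2_ge0.
rewrite -ler_pdivrMr// mulrC -[X in X * _]gtr0_norm ?invr_gt0//.
rewrite -norm2Z scalemxAr; apply: ub_le_sup.
  exists (Num.sqrt (\sum_i norm2 (row i M)^T ^+ 2)) => _ [z /= z1 <-].
  apply: le_trans (norm2_mulmx_bound M z) _.
  by rewrite ler_piMr ?sqrtr_ge0.
by exists ((norm2 x)^-1 *: x) => //=; rewrite norm2Z gtr0_norm ?invr_gt0// mulVf.
Qed.

End Euclidean.

(** * Norms on R^n and their dual norms *)

Lemma mx_norm_trmx (R : realType) m n (M : 'M[R]_(m, n)) : `|M^T| = `|M|.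
Proof.
have tr_le p q (A : 'M[R]_(p, q)) : `|A^T| <= `|A|.
  rewrite [leLHS]/Num.Def.normr/= mx_normrE; apply/bigmax_leP; split=> // ij _.
  by rewrite mxE ler_mx_norm_entry.
by apply/eqP; rewrite eq_le tr_le -{1}(trmxK M) tr_le.
Qed.

Section Norms.
Variables (R : realType) (n : nat) (N : 'cV[R]_n -> R).
Hypothesis N_norm : is_norm N.

Lemma is_normZ a x : N (a *: x) = `|a| * N x.
Proof. exact: is_norm_scale. Qed.

Lemma is_norm0 : N 0 = 0.
Proof. by rewrite -(scale0r 0) is_normZ normr0 mul0r. Qed.

Lemma is_normN x : N (- x) = N x.
Proof. by rewrite -scaleN1r is_normZ normrN1 mul1r. Qed.

Lemma is_norm_ge0 x : 0 <= N x.
Proof.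
have := is_norm_triangle N_norm x (- x).
by rewrite subrr is_norm0 is_normN -mulr2n pmulrn_lge0.
Qed.

Lemma is_norm_le_mx_norm x : N x <= (\sum_i N (delta_mx i ord0)) * `|x|.
Proof.
have {1}-> : x = \sum_i x i ord0 *: delta_mx i ord0.
  rewrite [LHS]matrix_sum_delta; apply: eq_bigr => i _.
  by rewrite big_ord_recl big_ord0 addr0.
rewrite mulr_suml; elim/big_ind2 : _ => [|a b c d ab cd|i _].
- by rewrite is_norm0.
- exact: le_trans (is_norm_triangle N_norm _ _) (lerD ab cd).
- by rewrite is_normZ mulrC ler_wpM2l ?is_norm_ge0// ler_mx_norm_entry.
Qed.

Lemma is_norm_dist x y : `|N x - N y| <= N (x - y).
Proof.
have half a b : N a - N b <= N (a - b).
  by rewrite lerBlDr (le_trans _ (is_norm_triangle N_norm _ _))// subrK.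
by rewrite ler_norml half andbT lerNl opprB -(is_normN (x - y)) opprB half.
Qed.

Lemma is_norm_continuous : continuous (fun v : 'rV[R]_n => N v^T).
Proof.
move=> v; apply/(@cvgrPdist_le _ _ _ (nbhs v)) => e e0.
set S := \sum_i N (delta_mx i ord0).
have S1_gt0 : 0 < S + 1.
  by rewrite ltr_wpDl// sumr_ge0// => i _; exact: is_norm_ge0.
have d0 : 0 < e / (S + 1) by rewrite divr_gt0.
apply/nbhs_ballP; exists (e / (S + 1)) => //= w.
rewrite -ball_normE/= => /ltW vw_le.
apply: le_trans (is_norm_dist _ _) _; apply: le_trans (is_norm_le_mx_norm _) _.
rewrite -/S -linearB/= mx_norm_trmx.
apply: (@le_trans _ _ ((S + 1) * `|v - w|)); first by rewrite ler_wpM2r// lerDl.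
by rewrite mulrC -ler_pdivlMr.
Qed.

(** By compactness the continuous function [N] has a minimum on the unit sphere of
    the sup norm, and it is positive there. *)
Lemma mx_norm_le_is_norm : exists C : R, forall x, `|x| <= C * N x.
Proof.
have [allx0|/existsNP[z /eqP z0]] := pselect (forall x : 'cV[R]_n, x = 0).
  by exists 0 => x; rewrite [x]allx0 normr0 mul0r.
pose S := [set v : 'rV[R]_n | `|v| = 1].
have scale_in x : x != 0 -> S (`|x|^-1 *: x^T).
  move=> x0; rewrite /S/= normrZ mx_norm_trmx gtr0_norm ?invr_gt0 ?normr_gt0//.
  by rewrite mulVf// normr_eq0.
have S_compact : compact S.
  apply: bounded_closed_compact.
    by exists 1; split => // M M1 v /= ->; exact: ltW.
  apply: (@closed_comp _ _ (fun v : 'rV[R]_n => `|v|) [set 1]).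
    by move=> v _; exact: norm_continuous.
  exact: closed_eq.
have [v Sv Nv_min] := EVT_min_rV (ex_intro _ _ (scale_in z z0)) S_compact
  (continuous_subspaceT is_norm_continuous).
have Nv_gt0 : 0 < N v^T.
  rewrite lt_neqAle is_norm_ge0 andbT eq_sym; apply/eqP => /(is_norm_eq0 N_norm).
  move=> /(congr1 trmx); rewrite trmxK trmx0 => v0.
  by move: Sv; rewrite /S inE/= v0 normr0 => /esym/eqP; rewrite oner_eq0.
exists (N v^T)^-1 => x.
have [->|x0] := eqVneq x 0; first by rewrite normr0 is_norm0 mulr0.
have := Nv_min _ (mem_set (scale_in x x0)).
rewrite linearZ/= trmxK is_normZ gtr0_norm ?invr_gt0 ?normr_gt0//.
by rewrite ler_pdivlMl ?normr_gt0// mulrC ler_pdivlMl.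
Qed.

(** Homogeneity reduces to the unit ball of [N], on which the pairing with [y] is
    bounded by comparison with the sup norm, so that the supremum is finite. *)
Lemma le_dual_norm x y : dot y x <= dual_norm N y * N x.
Proof.
have [/(is_norm_eq0 N_norm) ->|Nx_neq0] := eqVneq (N x) 0.
  by rewrite dot0r is_norm0 mulr0.
have Nx_gt0 : 0 < N x by rewrite lt_neqAle eq_sym Nx_neq0 is_norm_ge0.
rewrite -ler_pdivrMr// mulrC -dotZr; apply: ub_le_sup; last first.
  by exists ((N x)^-1 *: x) => //=; rewrite is_normZ gtr0_norm ?invr_gt0// mulVf.
have [C le_C] := mx_norm_le_is_norm.
exists ((\sum_i `|y i ord0|) * `|C|) => _ [z /= z1 <-].
rewrite (le_trans (ler_norm _))// (le_trans (dot_le_mx_norm _ _))//.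
rewrite ler_wpM2l ?sumr_ge0// (le_trans (le_C z))//.
by rewrite (le_trans (ler_wpM2r (is_norm_ge0 z) (ler_norm C)))// ler_piMr.
Qed.

End Norms.

(** * Differentiability along segments and convexity *)

Section DiffWithin.
Variables (R : realType) (n : nat) (Omega : set 'cV[R]_n).

Lemma has_diff_withinP (W : normedModType R) (F : 'cV[R]_n -> W) x dF :
  has_diff_within Omega F x dF <->
  forall e : R, 0 < e -> exists2 r : R, 0 < r & forall y, Omega y ->
    `|y - x| < r -> `|F y - F x - dF (y - x)| <= e * `|y - x|.
Proof.
have funE : has_diff_within Omega F x dF <->
    F = (fun y => F x + dF (y - x)) +o_ (within Omega (nbhs x)) (fun y => y - x).
  by split=> [/funext|] F_o //; rewrite /has_diff_within {1}F_o.
apply: (iff_trans funE).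
apply: (iff_trans (eqaddoP _ F (fun y => F x + dF (y - x)) (fun y => y - x))).
split=> F_diff e e0.
  have /nbhs_ballP[r r0 F_near] := F_diff e e0.
  exists r => // y Oy yx; have := F_near y; rewrite -ball_normE/= distrC.
  by move=> /(_ yx Oy); rewrite opprD addrA.
have [r r0 F_near] := F_diff e e0.
apply/nbhs_ballP; exists r => // y; rewrite -ball_normE/= distrC => yx Oy.
by have := F_near y Oy yx; rewrite -addrA -opprD.
Qed.

Lemma has_diff_within_dot (F : 'cV[R]_n -> 'cV[R]_n) x dF w :
  has_diff_within Omega F x dF ->
  has_diff_within Omega (fun y => dot w (F y) : R^o) x (fun v => dot w (dF v)).
Proof.
move=> /has_diff_withinP F_diff; apply/has_diff_withinP => e e0.
set S := \sum_i `|w i ord0|.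
have S0 : 0 <= S by apply: sumr_ge0.
have S1 : 0 < S + 1 by rewrite ltr_wpDl.
have [r r0 F_near] := F_diff (e / (S + 1)) (divr_gt0 e0 S1).
exists r => // y Oy yx; rewrite -!dotBr.
apply: le_trans (dot_le_mx_norm _ _) _; rewrite -/S.
apply: (@le_trans _ _ ((S + 1) * `|F y - F x - dF (y - x)|)).
  by rewrite ler_wpM2r// lerDl.
by rewrite mulrC -ler_pdivlMr// mulrAC F_near.
Qed.

Lemma has_diff_within_line (F : 'cV[R]_n -> R) x (dF : 'cV[R]_n -> R) v :
  (forall a, dF (a *: v) = a * dF v) ->
  has_diff_within Omega (F : _ -> R^o) x dF ->
  forall e : R, 0 < e -> exists2 r : R, 0 < r & forall t, `|t| < r ->
    Omega (x + t *: v) -> `|F (x + t *: v) - F x - t * dF v| <= e * `|t|.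
Proof.
move=> dFZ /has_diff_withinP F_diff e e0.
have v1 : 0 < `|v| + 1 by rewrite ltr_wpDl.
have [r r0 F_near] := F_diff (e / (`|v| + 1)) (divr_gt0 e0 v1).
exists (r / (`|v| + 1)); first by rewrite divr_gt0.
move=> t tr Ot; have := F_near _ Ot; rewrite addrAC subrr add0r dFZ normrZ.
have tv_le : `|t| * `|v| <= `|t| * (`|v| + 1) by rewrite ler_wpM2l// lerDl.
rewrite (le_lt_trans tv_le) -?ltr_pdivlMr// => /(_ isT) /le_trans; apply.
by rewrite mulrAC ler_pdivrMr// -mulrA ler_wpM2l// ltW.
Qed.

Hypothesis Omega_convex : convex_set Omega.

Lemma convex_set_segment x v t :
  Omega x -> Omega (x + v) -> 0 <= t -> t <= 1 -> Omega (x + t *: v).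
Proof.
move=> Ox Oxv t0 t1.
have := Omega_convex (Itv01 t0 t1) (mem_set Oxv) (mem_set Ox).
rewrite inE /conv/= scalerDr scalerBl scale1r.
by rewrite addrC addrA subrK.
Qed.

(** The chord from [x] to [y] lies above the graph: divide by [t] the increment
    of [f] at [x + t (y - x)] and let [t] tend to [0]. *)
Lemma convex_function_ge_tangent (f : 'cV[R]_n -> R) gradf x y :
  convex_function Omega f -> gradient_on Omega f gradf -> Omega x -> Omega y ->
  dot (gradf x) (y - x) <= f y - f x.
Proof.
move=> f_convex f_diff Ox Oy; apply/ler_addgt0Pr => e e0.
have dotZ a : dot (gradf x) (a *: (y - x)) = a * dot (gradf x) (y - x).
  exact: dotZr.
have [r r0 f_near] := has_diff_within_line dotZ (f_diff x Ox) e0.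
pose t := Num.min 1 (r / 2).
have t0 : 0 < t by rewrite lt_min ltr01 divr_gt0.
have t1 : t <= 1 by rewrite ge_min lexx.
have tr : `|t| < r by rewrite gtr0_norm// gt_min ltr_pdivrMr// ltr_pMr// ltr1n orbT.
have Oxy : Omega (x + (y - x)) by rewrite addrC subrK.
have := f_near t tr (convex_set_segment Ox Oxy (ltW t0) t1).
have f_le : f (x + t *: (y - x)) <= t * f y + (1 - t) * f x.
  have -> : x + t *: (y - x) = t *: y + (1 - t) *: x.
    by rewrite scalerBr scalerBl scale1r addrCA.
  exact: (f_convex (Itv01 (ltW t0) t1) y x (mem_set Oy) (mem_set Ox)).
rewrite (gtr0_norm t0) ler_norml => /andP[near_le _].
rewrite -(ler_pM2l t0); lra.
Qed.

End DiffWithin.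

(** * Coercivity of the Hessian of a strongly convex function *)

Section HessianCoercive.
Variables (R : realType) (n : nat) (Omega : set 'cV[R]_n).
Variables (Phi : 'cV[R]_n -> R) (grad : 'cV[R]_n -> 'cV[R]_n).
Variables (hess : 'cV[R]_n -> 'M[R]_n) (N : 'cV[R]_n -> R) (L : R).
Hypotheses (Omega_convex : convex_set Omega) (N_norm : is_norm N).
Hypothesis hess_diff : hessian_on Omega grad hess.
Hypothesis Phi_strongly_convex : forall x y, Omega x -> Omega y ->
  bregman Phi grad x y >= 2^-1 * N (x - y) ^+ 2.
Hypothesis hess_lipschitz : forall x y, Omega x -> Omega y ->
  opnorm2 (hess x - hess y) <= L * norm2 (x - y).

(** Add the two strong convexity inequalities between [x] and [x + v]. *)
Lemma gradient_strongly_monotone x v : Omega x -> Omega (x + v) ->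
  N v ^+ 2 <= dot v (grad (x + v) - grad x).
Proof.
move=> Ox Oxv.
have := lerD (Phi_strongly_convex Oxv Ox) (Phi_strongly_convex Ox Oxv).
have -> : x + v - x = v by rewrite addrAC subrr add0r.
have -> : x - (x + v) = - v by rewrite opprD addNKr.
rewrite (is_normN N_norm) /bregman.
have -> : x + v - x = v by rewrite addrAC subrr add0r.
have -> : x - (x + v) = - v by rewrite opprD addNKr.
rewrite dotNr dotBr !(dotC v); nra.
Qed.

(** Differentiate [gradient_strongly_monotone] along the segment from [x] to
    [x + v].  Only directions pointing into [Omega] are reached in this way. *)
Lemma hessian_coercive_direction x v : Omega x -> Omega (x + v) ->
  N v ^+ 2 <= dot v (hess x *m v).
Proof.
move=> Ox Oxv; apply/ler_addgt0Pr => e e0.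
have dotZ a : dot v (hess x *m (a *: v)) = a * dot v (hess x *m v).
  by rewrite -scalemxAr dotZr.
have [r r0 grad_near] :=
  has_diff_within_line dotZ (has_diff_within_dot v (hess_diff Ox)) e0.
pose t := Num.min 1 (r / 2).
have t0 : 0 < t by rewrite lt_min ltr01 divr_gt0.
have t1 : t <= 1 by rewrite ge_min lexx.
have tr : `|t| < r by rewrite gtr0_norm// gt_min ltr_pdivrMr// ltr_pMr// ltr1n orbT.
have Ot := convex_set_segment Omega_convex Ox Oxv (ltW t0) t1.
have := gradient_strongly_monotone Ox Ot.
have := grad_near t tr Ot.
rewrite (is_normZ N_norm) (gtr0_norm t0) dotZl exprMn expr2 -mulrA ler_pM2l//.
rewrite ler_norml dotBr => /andP[_ near_le] mono_le.
rewrite -(ler_pM2l t0); lra.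
Qed.

(** From [x], the points [x + t (y - x)] with [y] interior and [t] positive are
    interior, so that every direction is admissible there; the bound passes to
    [x] as [t] tends to [0] because the Hessian is Lipschitz. *)
Lemma hessian_coercive x v : Omega° !=set0 -> Omega x ->
  N v ^+ 2 <= dot v (hess x *m v).
Proof.
move=> [y /nbhs_ballP[r r0 ball_Omega]] Ox.
have v1 : 0 < `|v| + 1 by rewrite ltr_wpDl.
(* small enough for [y + rho v] to stay in the ball around [y] *)
pose rho := r / 2 / (`|v| + 1).
have rho0 : 0 < rho by rewrite !divr_gt0.
have ball_in w : `|w| < r -> Omega (y + w).
  by move=> wr; apply: ball_Omega; rewrite -ball_normE/= opprD addNKr normrN.
have Oy : Omega y by rewrite -[y]addr0; apply: ball_in; rewrite normr0.
have Oyv : Omega (y + rho *: v).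
  apply: ball_in; rewrite normrZ gtr0_norm//.
  apply: (@le_lt_trans _ _ (rho * (`|v| + 1))).
    by apply: ler_wpM2l; [exact: ltW | rewrite lerDl].
  by rewrite divfK ?gt_eqF// ltr_pdivrMr// ltr_pMr// ltr1n.
have coercive_near t : 0 < t -> t <= 1 ->
    N v ^+ 2 <= dot v (hess (x + t *: (y - x)) *m v).
  move=> t0 t1.
  have Oxy : Omega (x + (y - x)) by rewrite addrC subrK.
  have Oz := convex_set_segment Omega_convex Ox Oxy (ltW t0) t1.
  have Oxyv : Omega (x + (y + rho *: v - x)) by rewrite addrC subrK.
  have := convex_set_segment Omega_convex Ox Oxyv (ltW t0) t1.
  have -> : x + t *: (y + rho *: v - x) = x + t *: (y - x) + (t * rho) *: v.
    by rewrite [y + _ - x]addrAC scalerDr scalerA addrA.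
  move=> /(hessian_coercive_direction Oz).
  rewrite (is_normZ N_norm) exprMn real_normK ?num_real//.
  by rewrite -scalemxAr dotZl dotZr mulrA -expr2 ler_pM2l// exprn_gt0// mulr_gt0.
(* [t * C] bounds the variation of the quadratic form between [x] and
   [x + t (y - x)], and [t] is chosen to make it at most [e] *)
set C := norm2 v * (L * norm2 (y - x) * norm2 v).
apply/ler_addgt0Pr => e e0.
have C1 : 0 < `|C| + 1 by rewrite ltr_wpDl.
pose t := Num.min 1 (e / (`|C| + 1)).
have t0 : 0 < t by rewrite lt_min ltr01 divr_gt0.
have t1 : t <= 1 by rewrite ge_min lexx.
have tC : t * C <= e.
  have : t * (`|C| + 1) <= e by rewrite -ler_pdivlMr// ge_min lexx orbT.
  apply: le_trans; rewrite ler_pM2l// (le_trans (ler_norm _))// lerDl.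
  exact: ler01.
apply: le_trans (coercive_near t t0 t1) _.
rewrite -lerBlDl -dotBr -mulmxBl.
apply: le_trans (cauchy_schwarz _ _) _; apply: le_trans tC.
rewrite /C mulrCA ler_wpM2l ?norm2_ge0//.
apply: le_trans (le_opnorm2 _ _) _; rewrite mulrA ler_wpM2r ?norm2_ge0//.
have Oxy : Omega (x + (y - x)) by rewrite addrC subrK.
have Oz := convex_set_segment Omega_convex Ox Oxy (ltW t0) t1.
apply: le_trans (hess_lipschitz Oz Ox) _.
have -> : x + t *: (y - x) - x = t *: (y - x) by rewrite addrAC subrr add0r.
by rewrite norm2Z (gtr0_norm t0) mulrCA.
Qed.

Lemma hessian_unitmx x : Omega° !=set0 -> Omega x -> hess x \in unitmx.
Proof.
move=> Omega_int Ox; rewrite -unitmx_tr -row_free_unit -kermx_eq0.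
apply/eqP/row_matrixP => i; rewrite row0.
have : row i (kermx (hess x)^T) *m (hess x)^T = 0.
  by rewrite -row_mul mulmx_ker row0.
move/(congr1 trmx); rewrite trmx_mul trmxK trmx0.
set v := (row i _)^T => Hv; apply/trmx_inj; rewrite trmx0 -/v.
apply: (is_norm_eq0 N_norm); apply/eqP; rewrite -sqrf_eq0 eq_le sqr_ge0 andbT.
by rewrite (le_trans (hessian_coercive v Omega_int Ox))// Hv dot0r.
Qed.

End HessianCoercive.

(** * Taylor's inequality along a segment *)

Section Taylor.
Variables (R : realType) (n : nat) (Omega : set 'cV[R]_n).
Variables (F : 'cV[R]_n -> R) (dF : 'cV[R]_n -> 'cV[R]_n -> R).
Hypothesis Omega_convex : convex_set Omega.
Hypothesis dFZ : forall x a v, dF x (a *: v) = a * dF x v.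
Hypothesis F_diff : forall x, Omega x ->
  has_diff_within Omega (F : _ -> R^o) x (dF x).

Variables x v : 'cV[R]_n.
Hypotheses (Ox : Omega x) (Oxv : Omega (x + v)).

Let on_segment (t : R) : t \in `[0, 1] -> Omega (x + t *: v).
Proof. by rewrite in_itv/= => /andP[t0 t1]; exact: convex_set_segment. Qed.

Lemma segment_expansion (t e : R) : t \in `[0, 1] -> 0 < e ->
  exists2 r : R, 0 < r & forall s, s \in `[0, 1] -> `|s - t| < r ->
    `|F (x + s *: v) - F (x + t *: v) - (s - t) * dF (x + t *: v) v|
      <= e * `|s - t|.
Proof.
move=> t01 e0.
have [r r0 F_near] := has_diff_within_line (fun a => dFZ _ a v)
  (F_diff (on_segment t01)) e0.
exists r => // s s01 st.
have xsE : x + s *: v = x + t *: v + (s - t) *: v.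
  by rewrite -addrA -scalerDl [t + _]addrC subrK.
by have := F_near _ st; rewrite -xsE; apply; exact: on_segment.
Qed.

(** Inside the segment, differentiability within [Omega] is two-sided along the
    line; at its ends only continuity survives, which is all that the mean value
    theorem requires. *)
Lemma segment_is_derive (t : R) : t \in `]0, 1[ ->
  is_derive t 1 (fun s : R => F (x + s *: v) : R^o) (dF (x + t *: v) v).
Proof.
move=> t01; have t01c : t \in `[0, 1] by exact: subset_itv_oo_cc.
set D := dF _ v; set g := fun s => _.
suff g_cvg : h^-1 *: ((g \o shift t) (h *: 1) - g t) @[h --> 0^'] --> D.
  by apply: DeriveDef; [exact: cvgP g_cvg | exact: cvg_lim g_cvg].
apply/cvgrPdist_le => e e0.
have [r r0 F_near] := segment_expansion t01c e0.
move: t01; rewrite in_itv/= => /andP[t0 t1].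
near=> h.
have h0 : h != 0 by near: h; exact: nbhs_dnbhs_neq.
have hr : `|h| < r by near: h; exact: dnbhs0_lt.
have ht : `|h| < t by near: h; exact: dnbhs0_lt.
have ht1 : `|h| < 1 - t by near: h; apply: dnbhs0_lt; rewrite subr_gt0.
have s01 : h + t \in `[0, 1].
  move: ht ht1; rewrite !ltr_norml in_itv/= => /andP[? _] /andP[_ ?].
  by apply/andP; split; lra.
have := F_near (h + t) s01; rewrite addrK => /(_ hr).
rewrite /= /shift/= [h *: 1]mulr1 /g -/D [in X in X -> _]mulrC.
move=> F_le; rewrite -(ler_pM2l (_ : 0 < `|h|)) ?normr_gt0// -normrM mulrBr.
rewrite mulrA mulfV// mul1r distrC [`|h| * e]mulrC.
by apply: le_trans F_le; rewrite [h * D]mulrC.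
Unshelve. all: by end_near. Qed.

Lemma segment_continuous :
  {within `[0, 1], continuous (fun s : R => F (x + s *: v))}.
Proof.
apply/subspace_continuousP => t t01; apply/cvgrPdist_le => e e0.
have [r r0 F_near] := segment_expansion t01 ltr01.
set D := dF (x + t *: v) v in F_near.
have D1 : 0 < `|D| + 1 by rewrite ltr_wpDl.
apply/nbhs_ballP; exists (Num.min r (e / (`|D| + 1))) => /=.
  by rewrite lt_min r0 divr_gt0.
move=> s; rewrite -ball_normE/= distrC lt_min => /andP[sr /ltW s_le] s01.
change (`|F (x + t *: v) - F (x + s *: v)| <= e); rewrite distrC.
have := F_near s s01 sr; rewrite mul1r => F_le.
have : `|(s - t) * D| <= `|s - t| * `|D| by rewrite normrM.
rewrite ler_pdivlMr// in s_le.
have := ler_normD (F (x + s *: v) - F (x + t *: v) - (s - t) * D) ((s - t) * D).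
rewrite subrK; lra.
Qed.

(** The remainder [F (x + t v) - t dF x v - C t^2 / 2] decreases along the
    segment. *)
Lemma taylor_remainder_le C :
  (forall t, 0 <= t -> t <= 1 -> dF (x + t *: v) v - dF x v <= C * t) ->
  F (x + v) - F x - dF x v <= C / 2.
Proof.
move=> dF_le.
pose g : R^o -> R^o := fun s => F (x + s *: v).
pose q : R^o -> R^o := dF x v \*: (id : R^o -> R^o) + (C / 2) \*: (id ^+ 2).
have qE s : q s = dF x v * s + C / 2 * (s * s) by [].
have q_derive s : is_derive s (1 : R) q (dF x v + C * s).
  apply: is_derive_eq; rewrite /GRing.scale/= mulr1 expr1 mulr1; lra.
have h_derive (t : R) : t \in `]0, 1[ -> is_derive t (1 : R) (g - q)
    (dF (x + t *: v) v - (dF x v + C * t)).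
  by move=> t01; apply: is_deriveB; exact: segment_is_derive.
have h_cont : {within `[0, 1], continuous (g - q)}.
  have q_cont : continuous q.
    move=> s; apply: differentiable_continuous.
    by apply/derivable1_diffP; exact: ex_derive.
  by move=> s; apply: continuousB; [exact: segment_continuous |
    exact: continuous_subspaceT].
have h_decr := @ler0_derive1_le_cc R (g - q) 0 1 _ _ h_cont.
have : (g - q) 1 <= (g - q) 0.
  apply: h_decr; rewrite ?in_itv/= ?lexx ?ler01// => t t01.
    by apply: ex_derive; exact: h_derive.
  have d := h_derive t t01; rewrite derive1E derive_val.
  move: t01; rewrite in_itv/= => /andP[/ltW t0 /ltW t1].
  by rewrite subr_le0 -lerBlDl dF_le.
change (g 1 - q 1 <= g 0 - q 0 -> F (x + v) - F x - dF x v <= C / 2).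
rewrite !qE /g scale1r scale0r addr0; lra.
Qed.

End Taylor.

(** * Averages of points of a convex set *)

Section Averages.
Variables (R : realType) (n : nat) (Omega : set 'cV[R]_n).
Hypothesis Omega_convex : convex_set Omega.
Variable u : nat -> 'cV[R]_n.
Hypothesis u_in : forall k, Omega (u k).

Let mean K : 'cV[R]_n := K%:R^-1 *: \sum_(k < K) u k.

Lemma convex_set_mean K : (0 < K)%N -> Omega (mean K).
Proof.
case: K => // K _; elim: K => [|K IH].
  by rewrite /mean big_ord_recl big_ord0 addr0 invr1 scale1r.
(* the new mean lies on the segment from the old one to the new point *)
have -> : mean K.+2 = mean K.+1 + K.+2%:R^-1 *: (u K.+1 - mean K.+1).
  have meanE j : j.+1%:R *: mean j.+1 = \sum_(k < j.+1) u k.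
    by rewrite /mean scalerA mulfV ?scale1r// pnatr_eq0.
  have K2 : K.+2%:R != 0 :> R by rewrite pnatr_eq0.
  apply: (scalerI K2); rewrite meanE big_ord_recr/= -meanE scalerDr
    [X in _ = _ + X]scalerA.
  by rewrite mulfV// scale1r -[K.+2%:R]natr1 scalerDl scale1r -addrA subrKC.
apply: convex_set_segment => //; first by rewrite addrC subrK.
by rewrite invf_le1// ler1n.
Qed.

(** Average the tangent inequalities at the mean: their linear terms cancel. *)
Lemma convex_function_mean_le (f : 'cV[R]_n -> R) gradf K :
  convex_function Omega f -> gradient_on Omega f gradf -> (0 < K)%N ->
  K%:R * f (mean K) <= \sum_(k < K) f (u k).
Proof.
move=> f_convex f_diff K0; set w := mean K.
have Ow : Omega w by exact: convex_set_mean.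
have K_neq0 : K%:R != 0 :> R by rewrite pnatr_eq0 -lt0n.
rewrite -subr_ge0.
have -> : \sum_(k < K) f (u k) - K%:R * f w = \sum_(k < K) (f (u k) - f w).
  by rewrite mulr_natl sumrB sumr_const card_ord.
have dev0 : \sum_(k < K) (u k - w) = 0.
  rewrite sumrB sumr_const card_ord -scaler_nat /w /mean scalerA mulfV//.
  by rewrite scale1r subrr.
apply: (@le_trans _ _ (dot (gradf w) (\sum_(k < K) (u k - w)))).
  by rewrite dev0 dot0r.
rewrite dot_sumr; apply: ler_sum => k _.
exact: (convex_function_ge_tangent Omega_convex f_convex f_diff Ow (u_in k)).
Qed.

End Averages.

(** * One step of the variable metric iteration *)

Section OneStep.
Variables (R : realType) (n : nat) (Omega : set 'cV[R]_n).
Variables (Phi : 'cV[R]_n -> R) (grad : 'cV[R]_n -> 'cV[R]_n).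
Variables (hess : 'cV[R]_n -> 'M[R]_n) (N : 'cV[R]_n -> R) (L : R).
Hypotheses (Omega_convex : convex_set Omega) (N_norm : is_norm N).
Hypothesis hess_diff : hessian_on Omega grad hess.
Hypothesis Phi_strongly_convex : forall x y, Omega x -> Omega y ->
  bregman Phi grad x y >= 2^-1 * N (x - y) ^+ 2.
Hypothesis hess_lipschitz : forall x y, Omega x -> Omega y ->
  opnorm2 (hess x - hess y) <= L * norm2 (x - y).

(** The gradient is tested against a fixed [w] so that the scalar Taylor
    inequality applies; the derivative then varies by at most
    [L * t * norm2 v ^+ 2 * norm2 w] by Cauchy-Schwarz. *)
Lemma gradient_taylor_le x v w : Omega x -> Omega (x + v) ->
  dot w (grad (x + v) - grad x - hess x *m v) <=
    L * norm2 v ^+ 2 * norm2 w / 2.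
Proof.
move=> Ox Oxv; rewrite !dotBr.
apply: (@taylor_remainder_le _ _ Omega (fun y => dot w (grad y))
  (fun y z => dot w (hess y *m z))) => //.
- by move=> y a z; rewrite -scalemxAr dotZr.
- by move=> y Oy; exact: has_diff_within_dot (hess_diff Oy).
move=> t t0 t1; rewrite -dotBr -mulmxBl.
have Ot := convex_set_segment Omega_convex Ox Oxv t0 t1.
apply: le_trans (cauchy_schwarz _ _) _.
have H_le : norm2 ((hess (x + t *: v) - hess x) *m v) <=
    L * (t * norm2 v) * norm2 v.
  apply: le_trans (le_opnorm2 _ _) _; rewrite ler_wpM2r ?norm2_ge0//.
  apply: le_trans (hess_lipschitz Ot Ox) _.
  by rewrite addrAC subrr add0r norm2Z ger0_norm.
apply: le_trans (ler_wpM2l (norm2_ge0 w) H_le) _.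
by rewrite le_eqVlt; apply/orP; left; apply/eqP; ring.
Qed.

Lemma bregman_three_points x y z :
  dot (grad x - grad y) (y - z) =
    bregman Phi grad z x - bregman Phi grad z y - bregman Phi grad y x.
Proof. by rewrite /bregman !(dotBl, dotBr); ring. Qed.

(** Split [x - z] at [y].  On [y - z], the vector [eta *: g] is the difference of
    gradients, treated by the three-point identity, plus a Taylor remainder.  On
    [x - y], Young's inequality leaves half the square of [N (x - y)], which the
    last divergence of the three-point identity absorbs. *)
Lemma variable_metric_step x y z g (eta : R) :
  Omega x -> Omega y -> Omega z -> 0 <= eta ->
  hess x *m (x - y) = eta *: g ->
  eta * dot g (x - z) <=
    bregman Phi grad z x - bregman Phi grad z y
    + 2^-1 * (eta * dual_norm N g) ^+ 2
    + L * norm2 (x - y) ^+ 2 * norm2 (z - y) / 2.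
Proof.
move=> Ox Oy Oz eta0 step.
have Oxy : Omega (x + (y - x)) by rewrite addrC subrK.
have := gradient_taylor_le (y - z) Ox Oxy.
have -> : x + (y - x) = y by rewrite addrC subrK.
rewrite -[y - x]opprB mulmxN step norm2N -[y - z]opprB norm2N opprB opprK.
have := bregman_three_points x y z.
have := Phi_strongly_convex Oy Ox.
rewrite -[y - x]opprB (is_normN N_norm).
have : eta * dot g (x - y) <= eta * dual_norm N g * N (x - y).
  by rewrite -mulrA ler_wpM2l// le_dual_norm.
have -> : eta * dot g (x - z) = eta * dot g (x - y) + eta * dot g (y - z).
  by rewrite -mulrDr -dotDr addrA subrK.
rewrite (dotC (y - z)) (dotDl (grad y - grad x)) dotZl -[grad y - grad x]opprB dotNl.
have := sqr_ge0 (eta * dual_norm N g - N (x - y)).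
nra.
Qed.

End OneStep.

(** * Convergence of the averaged iterates *)

Theorem theorem4 (R : realType) (m n : nat)
    (Omega : set 'cV[R]_n) (A : 'M[R]_(m, n)) (b : 'cV[R]_m)
    (f : 'cV[R]_n -> R) (gradf : 'cV[R]_n -> 'cV[R]_n)
    (Phi : 'cV[R]_n -> R) (gradPhi : 'cV[R]_n -> 'cV[R]_n)
    (hessPhi : 'cV[R]_n -> 'M[R]_n)
    (omega : 'cV[R]_n -> R) (L eta : R) (ustar u0 : 'cV[R]_n)
    (u : nat -> 'cV[R]_n) (c : 'cV[R]_n -> 'cV[R]_m)
    (Omega_convex : convex_set Omega)
    (f_convex : convex_function Omega f)
    (f_diff : gradient_on Omega f gradf)
    (ustar_min : unique_minimizer [set v | Omega v /\ A *m v = b] f ustar)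
    (Phi_diff : gradient_on Omega Phi gradPhi)
    (Phi_diff2 : hessian_on Omega gradPhi hessPhi)
    (omega_norm : is_norm omega)
    (Phi_strongly_convex : forall x y, Omega x -> Omega y ->
       bregman Phi gradPhi x y >= 2^-1 * omega (x - y) ^+ 2)
    (hessPhi_lipschitz : forall x y, Omega x -> Omega y ->
       opnorm2 (hessPhi x - hessPhi y) <= L * norm2 (x - y))
    (eta_gt0 : 0 < eta)
    (u_init : u 0%N = u0)
    (u0_feasible : A *m u0 = b)
    (u_in : forall k, Omega (u k))
    (* If Omega has nonempty interior, the Hessian is unique and invertible by
       strong convexity; otherwise the inverse is only meaningful under the
       following proviso. *)
    (hessPhi_unit : interior Omega = set0 -> forall k, hessPhi (u k) \in unitmx)
    (u_step : forall k, u k.+1 =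
       u k - eta *: (invmx (hessPhi (u k)) *m (gradf (u k) + A^T *m c (u k))))
    (c_feasible : forall k, A *m u k.+1 = b)
    (K : nat) (K_ge1 : (1 <= K)%N) :
  f (K%:R^-1 *: \sum_(k < K) u k) - f ustar <=
    (eta * K%:R)^-1 * bregman Phi gradPhi ustar u0
    + K%:R^-1 * \sum_(k < K)
        (eta / 2 * dual_norm omega (gradf (u k) + A^T *m c (u k)) ^+ 2)
    + L * eta / 2 * (K%:R^-1 * \sum_(k < K)
        (norm2 (invmx (hessPhi (u k)) *m (gradf (u k) + A^T *m c (u k))) ^+ 2
         * norm2 (ustar - u k.+1))).
Proof.
have [[Ostar Astar] _ _] := ustar_min.
pose g k := gradf (u k) + A^T *m c (u k).
pose d k := invmx (hessPhi (u k)) *m g k.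
pose D k := bregman Phi gradPhi ustar (u k).
have Au k : A *m u k = b by case: k => [|k]; rewrite ?u_init.
have H_unit k : hessPhi (u k) \in unitmx.
  have [/hessPhi_unit//|/set0P Omega_int] := eqVneq (interior Omega) set0.
  exact: (hessian_unitmx Omega_convex omega_norm Phi_diff2 Phi_strongly_convex
    hessPhi_lipschitz).
have stepE k : u k - u k.+1 = eta *: d k by rewrite u_step subKr.
have gap_le k : f (u k) - f ustar <= dot (g k) (u k - ustar).
  have := convex_function_ge_tangent Omega_convex f_convex f_diff (u_in k) Ostar.
  rewrite /g dotDl dot_trmxl mulmxBr Au Astar subrr dot0r addr0.
  by rewrite -[ustar - _]opprB dotNr; lra.
have descent k : eta * (f (u k) - f ustar) <= D k - D k.+1
    + eta * (eta / 2 * dual_norm omega (g k) ^+ 2)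
    + eta * (L * eta / 2) * (norm2 (d k) ^+ 2 * norm2 (ustar - u k.+1)).
  apply: le_trans (ler_wpM2l (ltW eta_gt0) (gap_le k)) _.
  have Hstep : hessPhi (u k) *m (u k - u k.+1) = eta *: g k.
    by rewrite stepE -scalemxAr /d mulKVmx.
  have := variable_metric_step Omega_convex omega_norm Phi_diff2
    Phi_strongly_convex hessPhi_lipschitz (u_in k) (u_in k.+1) Ostar
    (ltW eta_gt0) Hstep.
  rewrite stepE norm2Z (gtr0_norm eta_gt0) -/(D k) -/(D k.+1) => /le_trans; apply.
  by rewrite le_eqVlt; apply/orP; left; apply/eqP; field.
have K_gt0 : 0 < K%:R :> R by rewrite ltr0n.
have D_ge0 : 0 <= D K.
  apply: le_trans (Phi_strongly_convex _ _ Ostar (u_in K)).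
  by rewrite mulr_ge0 ?sqr_ge0.
have mean_le := convex_function_mean_le Omega_convex u_in f_convex f_diff K_ge1.
have D_telescope : \sum_(k < K) (D k - D k.+1) = D 0%N - D K.
  rewrite -(big_mkord xpredT (fun k => D k - D k.+1)).
  rewrite -[RHS]opprB -telescope_sumr// -sumrN.
  by apply: eq_bigr => k _; rewrite opprB.
pose S0 := \sum_(k < K) f (u k).
pose S1 := \sum_(k < K) (eta / 2 * dual_norm omega (g k) ^+ 2).
pose S2 := \sum_(k < K) (norm2 (d k) ^+ 2 * norm2 (ustar - u k.+1)).
have sum_le : eta * (S0 - K%:R * f ustar) <=
    D 0%N - D K + eta * S1 + eta * (L * eta / 2) * S2.
  have -> : S0 - K%:R * f ustar = \sum_(k < K) (f (u k) - f ustar).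
    by rewrite mulr_natl sumrB sumr_const card_ord.
  rewrite -D_telescope !mulr_sumr -!big_split/=.
  by apply: ler_sum => k _; exact: descent.
rewrite -/S1 -/S2; set F := f (_ *: _) in mean_le *.
have Keta_gt0 : 0 < eta * K%:R by rewrite mulr_gt0.
rewrite -(ler_pM2l Keta_gt0).
have -> : eta * K%:R * ((eta * K%:R)^-1 * bregman Phi gradPhi ustar u0
    + K%:R^-1 * S1 + L * eta / 2 * (K%:R^-1 * S2)) =
    bregman Phi gradPhi ustar u0 + eta * S1 + eta * (L * eta / 2) * S2.
  by field; rewrite !gt_eqF.
apply: le_trans (_ : eta * (S0 - K%:R * f ustar) <= _).
  by rewrite -mulrA ler_pM2l// mulrBr lerD2r.
by apply: le_trans sum_le _; rewrite /D u_init in D_ge0 *; lra.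
Qed.
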